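(* Let $\Sigma=\{1,\dots,k\}$, $W=12\cdots k$, and let $F$ be a frog arrangement sampled according to the stationary distribution of the frog dynamics associated with $W$. Let $1\le m\le k-1$, let $\ell_{m+1}<\ell_m<\ell_{m-1}<\dotsb<\ell_1<\ell_{m+1}+k$ be integers, and set $\Delta_i=\ell_i-\ell_{i+1}$ for $i\in\{1,\dots,m\}$. Then $$\Pr\bigl[F(f_{m+1})=\ell_{m+1}\ \big|\ \{F(f_1),\dots,F(f_m)\}=\{\ell_1,\dotsc,\ell_m\}\bigr]=\frac{1}{\binom{k}{m+1}}\sum_{(a_1,\dots,a_m)}\ \prod_{i=1}^m\binom{\Delta_i}{a_i},$$ where the positions $\ell_i$ are understood modulo $k$ and the sum is over all tuples of integers $a_1,\dots,a_m\ge 0$ satisfying $\sum_{i\le j}a_i\le j$ for every $j\in\{1,\dots,m\}$ and $\sum_{i\le m}a_i=m$.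
   Context: Frog dynamics: let $W=W_0\cdots W_{k-1}\in\Sigma^k$. There are $k$ lily pads indexed by $\mathbb{Z}/k\mathbb{Z}$, pad $i$ being labeled $W_i$, and $k$ frogs $f_1,\dots,f_k$, where $f_i$ is nastier than $f_j$ iff $i<j$. A frog arrangement is a bijection $F:\{f_1,\dots,f_k\}\to\mathbb{Z}/k\mathbb{Z}$. For a symbol $c\in\Sigma$, the arrangement $Fc$ is obtained as follows. Initially, the agitated frogs are exactly those sitting on pads labeled $c$. As long as some frog is agitated, let $f_m$ be the nastiest agitated frog, currently on pad $x$; it leaves $x$ and leaps to pad $x+y$, where $y\in\{1,\dots,k\}$ is the least integer such that pad $x+y$ is not currently occupied by a frog nastier than $f_m$; then $f_m$ calms down and any other frog currently on pad $x+y$ becomes agitated. (Each frog moves at most once.) The final positions form the arrangement $Fc$. The frog dynamics associated with $W$ is the Markov chain $F_{i+1}=F_iR_i$ on frog arrangements, where $R_0,R_1,\dots$ are independent uniformly random symbols of $\Sigma$. For $W=12\cdots k$ it has a unique stationary distribution. *)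

(* Defs.v *)
From mathcomp Require Import all_boot all_order all_algebra all_fingroup.

Set Implicit Arguments.
Unset Strict Implicit.
Unset Printing Implicit Defensive.

Import Order.TTheory GRing.Theory Num.Theory.

(* Frogs and pads are both numbered from 0: the frog f_(i+1) is i : 'I_k, and  *)
(* the pad j of Z/kZ is its representative j : 'I_k. A smaller frog index is   *)
(* nastier.                                                                    *)

Definition frog_arrangement (k : nat) := {perm 'I_k}.

Definition pad_add (k : nat) (x : 'I_k) (y : nat) : 'I_k := iter y (@ordS k) x.

(* While the frogs are moving, several of them may share a pad, so positions   *)
(* are not required to be injective here.                                      *)
Record frog_state (k : nat) := FrogState {
  position : {ffun 'I_k -> 'I_k};
  agitated : {set 'I_k}
}.

Definition nastiest (k : nat) (A : {set 'I_k}) : option 'I_k :=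
  [pick i in A | [forall j in A, i <= j]].

Definition nastier_on (k : nat) (p : {ffun 'I_k -> 'I_k}) (i x : 'I_k) : bool :=
  [exists j : 'I_k, (j < i) && (p j == x)].

(* The least y in {1, ..., k} such that pad (p i) + y holds no frog nastier    *)
(* than i; such a y always exists (leap_lengthP below).                        *)
Definition leap_length (k : nat) (p : {ffun 'I_k -> 'I_k}) (i : 'I_k) : nat :=
  (find (fun y => ~~ nastier_on p i (pad_add (p i) y)) (iota 1 k)).+1.

Definition leap_target (k : nat) (p : {ffun 'I_k -> 'I_k}) (i : 'I_k) : 'I_k :=
  pad_add (p i) (leap_length p i).

Definition leap (k : nat) (s : frog_state k) : frog_state k :=
  if nastiest (agitated s) is Some i then
    let t := leap_target (position s) i in
    FrogState
      [ffun j => if j == i then t else position s j]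
      ((agitated s :\ i) :|: [set j | (j != i) && (position s j == t)])
  else s.

Definition initial_state (Sigma : eqType) (k : nat) (W : 'I_k -> Sigma)
    (F : frog_arrangement k) (c : Sigma) : frog_state k :=
  FrogState (finfun F) [set i | W (F i) == c].

(* Leaps are performed in order of increasing frog index, so after k leaps no  *)
(* frog is agitated (final_state_calm below) and the process has stopped.      *)
Definition final_state (Sigma : eqType) (k : nat) (W : 'I_k -> Sigma)
    (F : frog_arrangement k) (c : Sigma) : frog_state k :=
  iter k (@leap k) (initial_state W F c).

Section FrogDynamicsFacts.
Variable k : nat.
Implicit Types (p : {ffun 'I_k -> 'I_k}) (i j x : 'I_k) (s : frog_state k).

Lemma val_pad_add x y : pad_add x y = (x + y) %% k :> nat.
Proof.
elim: y => [|y IHy]; first by rewrite addn0 modn_small.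
by rewrite /= -/(pad_add x y) IHy -addn1 modnDml addn1 addnS.
Qed.

Lemma free_padP p i : exists x, ~~ nastier_on p i x.
Proof.
apply/existsP; rewrite -[X in is_true X]negbK negb_exists; apply/negP => /forallP full.
have : #|[set: 'I_k]| <= #|p @: [set j : 'I_k | j < i]|.
  apply/subset_leq_card/subsetP => x _.
  have := full x; rewrite negbK => /existsP[j /andP[ji /eqP <-]].
  by apply: imset_f; rewrite inE.
rewrite cardsT card_ord leqNgt => /negP; apply.
apply: leq_ltn_trans (leq_imset_card _ _) _.
rewrite -[X in _ < X]card_ord -cardsT; apply: proper_card.
by apply/properP; split; [exact: subsetT|exists i; rewrite ?inE ?ltnn].
Qed.

Lemma leap_lengthP p i :
  [/\ 0 < leap_length p i <= k,
      ~~ nastier_on p i (leap_target p i)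
    & forall y, 0 < y < leap_length p i -> nastier_on p i (pad_add (p i) y)].
Proof.
rewrite /leap_target /leap_length; set P := fun y => ~~ _.
have hasP : has P (iota 1 k).
  have [x xfree] := free_padP p i; apply/hasP.
  have k0 : 0 < k by apply: leq_ltn_trans (ltn_ord i).
  pose y := ((x + (k - p i)) + k.-1) %% k.
  exists y.+1; first by rewrite mem_iota /= add1n ltnS ltn_mod.
  rewrite /P; suff -> : pad_add (p i) y.+1 = x by [].
  apply: ord_inj; rewrite val_pad_add addnS -addn1 /y.
  rewrite -modnDml modnDmr modnDml -addnA addn1 -addnS (prednK k0).
  by rewrite addnA addnCA subnKC ?(ltnW (ltn_ord _)) // !modnDr modn_small.
have fk : find P (iota 1 k) < k by rewrite -[X in _ < X](size_iota 1) -has_find.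
split.
- by rewrite fk.
- by have := nth_find 0 hasP; rewrite nth_iota.
- case=> // y /= yf; have yk : y < k by apply: leq_trans fk; apply: ltnW.
  by have := before_find 0 (yf : y < _); rewrite nth_iota // => /negbFE.
Qed.

Lemma nastiestP (A : {set 'I_k}) :
  match nastiest A with
  | Some i => i \in A /\ (forall j, j \in A -> i <= j)
  | None => A = set0
  end.
Proof.
rewrite /nastiest; case: pickP => [i /andP[iA /forall_inP le_i]|noA]; first by split.
apply/eqP/set0Pn => -[x xA].
have := noA [arg min_(i < x in A) i].
by case: arg_minnP => // i iA le_i; rewrite iA /=; case: forall_inP.
Qed.

Definition leap_inv (n : nat) s :=
  {in ~: agitated s &, injective (position s)} /\
  (forall i, i \in agitated s -> n <= i).

Lemma leap_invS n s : leap_inv n s -> leap_inv n.+1 (leap s).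
Proof.
move=> [inj_s le_s]; rewrite /leap.
have := nastiestP (agitated s); case: (nastiest _) => [i [iA le_i]|A0]; last first.
  by split=> // i; rewrite A0 inE.
set t := leap_target _ _; split=> /=.
  have out j : j \in ~: (agitated s :\ i :|: [set j | (j != i) && (position s j == t)]) ->
      j != i -> j \in ~: agitated s /\ position s j != t.
    by rewrite !inE => + ji; rewrite ji /= negb_or => /andP[].
  move=> a b /out aout /out bout; rewrite !ffunE.
  have [->|ai] := eqVneq a i; have [->|bi] := eqVneq b i => //.
  - by move=> tE; have [_] := bout bi; rewrite -tE eqxx.
  - by move=> tE; have [_] := aout ai; rewrite tE eqxx.
  - by apply: inj_s; [have [] := aout ai|have [] := bout bi].
move=> j; rewrite !inE => /orP[/andP[ji jA]|/andP[ji /eqP jt]].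
  apply: leq_ltn_trans (le_s _ iA) _.
  by rewrite ltn_neqAle le_i // andbT eq_sym.
apply: leq_ltn_trans (le_s _ iA) _.
rewrite ltn_neqAle eq_sym ji /= leqNgt; apply/negP => lt_ji.
have [_ /existsP + _] := leap_lengthP (position s) i; apply.
by exists j; rewrite lt_ji jt eqxx.
Qed.

Variables (Sigma : eqType) (W : 'I_k -> Sigma).

Lemma final_state_inv F c : leap_inv k (final_state W F c).
Proof.
have init : leap_inv 0 (initial_state W F c).
  by split=> //= a b _ _; rewrite !ffunE; apply: perm_inj.
have iter_inv n : leap_inv n (iter n (@leap k) (initial_state W F c)).
  by elim: n => //= n; apply: leap_invS.
exact: iter_inv.
Qed.

Lemma final_state_calm F c : agitated (final_state W F c) = set0.
Proof.
have [_ le_k] := final_state_inv F c.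
by apply/eqP/set0Pn => -[i /le_k]; rewrite leqNgt ltn_ord.
Qed.

Lemma final_position_inj F c : injective (position (final_state W F c)).
Proof.
have [inj_s _] := final_state_inv F c.
by move=> a b; apply: inj_s; rewrite final_state_calm !inE.
Qed.

End FrogDynamicsFacts.

Definition frog_act (Sigma : eqType) (k : nat) (W : 'I_k -> Sigma)
    (F : frog_arrangement k) (c : Sigma) : frog_arrangement k :=
  perm (@final_position_inj k Sigma W F c).

Local Open Scope ring_scope.

Definition distribution (R : realFieldType) (T : finType) (mu : T -> R) : Prop :=
  (forall x, 0 <= mu x) /\ \sum_x mu x = 1.

Definition stationary (R : realFieldType) (T : finType) (K : T -> T -> R)
    (mu : T -> R) : Prop :=
  distribution mu /\ (forall y, \sum_x mu x * K x y = mu y).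

Definition Pr (R : realFieldType) (T : finType) (mu : T -> R) (E : pred T) : R :=
  \sum_(x | E x) mu x.

Definition cPr (R : realFieldType) (T : finType) (mu : T -> R) (A B : pred T) : R :=
  Pr mu (predI A B) / Pr mu B.

Definition frog_kernel (R : realFieldType) (Sigma : finType) (k : nat)
    (W : 'I_k -> Sigma) (F G : frog_arrangement k) : R :=
  #|[set c : Sigma | frog_act W F c == G]|%:R / #|Sigma|%:R.

(* The pad x is the integer z read modulo k. *)
Definition is_pad (k : nat) (z : int) (x : 'I_k) : bool :=
  ((x : nat)%:Z == z %[mod k])%Z.

(* The tuples (a_1, ..., a_m) of nonnegative integers whose first j entries    *)
(* sum to at most j, for every j, and whose total is m; a_(i+1) is a i. The    *)
(* total forces each entry to be at most m, whence the codomain 'I_m.+1.       *)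
Definition admissible (m : nat) (a : {ffun 'I_m -> 'I_m.+1}) : bool :=
  [forall j : 'I_m, (\sum_(i < m | (i <= j)%N) a i <= j.+1)%N]
  && (\sum_(i < m) a i == m)%N.

(* Main.v *)
Require Import Defs.
From mathcomp Require Import all_boot all_order all_algebra all_fingroup.
From mathcomp Require Import zify.

(**
A frog never disturbs a nastier one, so the set of pads of the j nastiest
frogs evolves on its own: the symbol c makes the particle on pad c, if there
is one, hop to the next vacant pad [nasty_pads_act]. Hence, when F is
stationary, the nested pair (S, T) of the pads of the m and of the m + 1
nastiest frogs has a stationary law for the chain in which both sets are
pushed by the same random symbol, and f_(m+1) sits on the only pad of T not
in S. The theorem follows once the laws of S and of (S, T) are known.

Each of these chains has at most one stationary law on sets of the right
sizes: sweeping the symbols 0, 1, 2, ... drives all particles to the last pads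
whatever the initial set was [sync_push2], and a signed stationary weight of
total 0 cannot survive a word that merges all states [balanced_unique]. It
remains to guess the two laws.

For S it is the uniform law, because (S, c) determines and is determined by
the pushed set together with the pad where the particle lands [push_inj].

For (S, T) one uses two independent uniform rows X and Y of m and m + 1
pads, in the manner of the multiline queues of Ferrari and Martin. Read the
circle as time, X as arrivals and Y as services of a queue: every customer is
served, and exactly one service u stays idle [idle_exists, queue_idle_unique].
Push Y by c, and then push X by the pad where Y's particle has landed. This
step on triples (X, Y, c) is again reversible, so it preserves the uniform
law, and it makes the pair (Y minus u, Y) follow the chain of (S, T)
[queue_push, push_idle]. So the law of (S, T) is that of (Y minus u, Y).

Consequently the conditional probability is the number of X for which the
service at l_(m+1) is the idle one among l_(m+1) < ... < l_1, divided by
C(k, m+1). Let a_i be the number of arrivals in (l_(i+1), l_i]. The services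
at l_m, ..., l_1 are all used exactly when, for every j, at least m - j
customers have arrived by the time l_(j+1), and the total m of the a_i turns
this into a_1 + ... + a_j <= j [card_idle].
*)

Set Implicit Arguments.
Unset Strict Implicit.
Unset Printing Implicit Defensive.

Import Order.TTheory GRing.Theory Num.Theory.

(** * Pads around the circle *)

Lemma card_ord_lt k n : n <= k -> #|[set x : 'I_k | x < n]| = n.
Proof. by move=> nk; rewrite -sum1dep_card (big_ord_narrow nk) sum1_card card_ord. Qed.

Section Circle.
Variable k : nat.
Implicit Types (A B X Y : {set 'I_k}) (c d t s u x y : 'I_k).

(** Clockwise distance from c to t. *)
Definition offset c t : nat := (t + (k - c)) %% k.

Lemma pos_k (x : 'I_k) : 0 < k.
Proof. by apply: leq_ltn_trans (ltn_ord x). Qed.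

Lemma offset_lt c t : offset c t < k.
Proof. by rewrite ltn_mod (pos_k c). Qed.

Lemma pad_add_offset c t : pad_add c (offset c t) = t.
Proof.
apply: ord_inj; rewrite val_pad_add modnDmr addnCA subnKC ?(ltnW (ltn_ord _)) //.
by rewrite modnDr modn_small.
Qed.

Lemma offset_pad_add c n : n < k -> offset c (pad_add c n) = n.
Proof.
move=> nk; rewrite /offset val_pad_add modnDml addnAC subnKC ?(ltnW (ltn_ord _)) //.
by rewrite modnDl modn_small.
Qed.

Lemma offset_inj c : injective (offset c).
Proof. by move=> s t st; rewrite -(pad_add_offset c s) st pad_add_offset. Qed.

Lemma pad_add_k c : pad_add c k = c.
Proof. by apply: ord_inj; rewrite val_pad_add modnDr modn_small. Qed.

Lemma offset_same c : offset c c = 0.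
Proof. by rewrite -[X in offset _ X]/(pad_add c 0) offset_pad_add // (pos_k c). Qed.

Lemma offset_eq0 c t : (offset c t == 0) = (t == c).
Proof. by rewrite -{1}(offset_same c) (inj_eq (@offset_inj c)). Qed.

Lemma pad_addD c m n : pad_add (pad_add c m) n = pad_add c (m + n).
Proof. by rewrite /pad_add -iterD addnC. Qed.

Lemma pad_add_inj n : injective (fun x : 'I_k => pad_add x n).
Proof.
elim: n => [|n IHn] x y //= /(can_inj (@ordSK k)); exact: IHn.
Qed.

Lemma offset_ordS c s :
  if ordS s == c then offset c s = k.-1 /\ offset c (ordS s) = 0
  else offset c (ordS s) = (offset c s).+1.
Proof.
have k0 := pos_k c.
have sE : ordS s = pad_add c (offset c s).+1 by rewrite [RHS]/= -/(pad_add _ _) pad_add_offset.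
have [lt|] := ltnP (offset c s).+1 k.
  have e : offset c (ordS s) = (offset c s).+1 by rewrite sE offset_pad_add.
  by rewrite -offset_eq0 e.
move=> ge; have ek : (offset c s).+1 = k by have := offset_lt c s; lia.
by rewrite sE ek pad_add_k eqxx offset_same; split=> //; lia.
Qed.

(** The indicator of the n pads from c on changes only at the two ends of the
    arc. Queue lengths below are modified by such indicators, so this turns
    each verification into linear arithmetic; n = k, a full turn, is included
    since then both ends are c. *)
Lemma arc_step c n s : n <= k ->
  (offset c (ordS s) < n) + (ordS s == pad_add c n)
  = (offset c s < n) + (ordS s == c) :> nat.
Proof.
move=> nk; have k0 := pos_k c; have := offset_ordS c s; have ls := offset_lt c s.
have [nk' | ->] : n < k \/ n = k by lia.
  have -> : (ordS s == pad_add c n) = (offset c (ordS s) == n).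
    by rewrite -(inj_eq (@offset_inj c)) offset_pad_add.
  by case: ifP => [_ [-> ->]|_ ->]; lia.
by rewrite pad_add_k !offset_lt.
Qed.

Lemma pad_ind c (P : pred 'I_k) : P c -> (forall s, P s -> P (ordS s)) -> forall t, P t.
Proof.
move=> P0 PS t; rewrite -(pad_add_offset c t).
by elim: (offset c t) => //= n; apply: PS.
Qed.

(** Distance from x to the next vacant pad, which is x itself after a full turn
    when x is the only pad outside B. *)
Definition gap B x : nat :=
  (find (fun n => pad_add x n \notin B) (iota 1 k)).+1.

Definition first_free B x : 'I_k := pad_add x (gap B x).

Lemma gapP B x z : z \notin B ->
  [/\ 0 < gap B x <= k, first_free B x \notin B
    & forall i, 0 < i < gap B x -> pad_add x i \in B].
Proof.
move=> zB; rewrite /first_free /gap; set P := fun n => _ \notin B.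
have k0 := pos_k x.
have hasP : has P (iota 1 k).
  apply/hasP; have [xz|xz] := eqVneq z x.
    by exists k; rewrite ?mem_iota ?/P ?pad_add_k -?xz //; lia.
  exists (offset x z); last by rewrite /P pad_add_offset.
  by rewrite mem_iota lt0n offset_eq0 xz /= add1n ltnS ltnW ?offset_lt.
have fk : find P (iota 1 k) < k by rewrite -[X in _ < X](size_iota 1) -has_find.
split.
- by rewrite fk.
- by have := nth_find 0 hasP; rewrite nth_iota.
- case=> // n /= nf; have nk : n < k by apply: leq_trans fk; apply: ltnW.
  by have := before_find 0 (nf : n < _); rewrite nth_iota // => /negbFE.
Qed.

Lemma gap_unique B x n : 0 < n -> pad_add x n \notin B ->
  (forall i, 0 < i < n -> pad_add x i \in B) -> gap B x = n.
Proof.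
move=> n0 nB ltB; have [/andP[g0 gk] gB gltB] := gapP x nB.
have [lt|lt|//] := ltngtP (gap B x) n.
- by have := ltB (gap B x); rewrite (negPf (gB : pad_add x (gap B x) \notin B)) g0 lt => /(_ isT).
- by have := gltB n; rewrite (negPf nB) n0 lt => /(_ isT).
Qed.

Lemma first_free_unique B x n : 0 < n -> pad_add x n \notin B ->
  (forall i, 0 < i < n -> pad_add x i \in B) -> first_free B x = pad_add x n.
Proof. by move=> n0 nB ltB; rewrite /first_free (gap_unique n0). Qed.

Lemma first_free_skip B x n z : z \notin B ->
  (forall i, 0 < i <= n -> pad_add x i \in B) ->
  first_free B (pad_add x n) = first_free B x.
Proof.
move=> zB leB; have [/andP[g0 gk] gB gltB] := gapP x zB.
have ng : n < gap B x.
  rewrite ltnNge; apply/negP => le; have := leB (gap B x).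
  by rewrite (negPf (gB : pad_add x (gap B x) \notin B)) g0 le => /(_ isT).
have e : n + (gap B x - n) = gap B x by lia.
rewrite (@first_free_unique _ _ (gap B x - n)) ?pad_addD ?e //; first by lia.
by move=> i hi; rewrite pad_addD; apply: gltB; lia.
Qed.

(** The particle on c is lifted before it looks for a vacant pad, so it comes
    back to c when A is full. *)
Definition push A c : {set 'I_k} :=
  if c \in A then first_free (A :\ c) c |: (A :\ c) else A.

(** Where the disturbance created at c ends: a symbol that hits no particle
    passes through. *)
Definition landing A c : 'I_k := if c \in A then first_free (A :\ c) c else c.

Definition hop A c : nat := if c \in A then gap (A :\ c) c else 0.

Lemma landingE A c : landing A c = pad_add c (hop A c).
Proof. by rewrite /landing /hop; case: ifP. Qed.

Lemma landing_free A c : landing A c \notin A :\ c.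
Proof.
rewrite /landing; case: ifP => [cA|/negbT cA]; last by rewrite !inE (negPf cA) andbF.
by have [] := gapP c (negbT (setD11 c A)).
Qed.

Lemma hop_le A c : hop A c <= k.
Proof.
rewrite /hop; case: ifP => // cA.
by have [/andP[]] := gapP c (negbT (setD11 c A)).
Qed.

Lemma hop_gt0 A c : (0 < hop A c) = (c \in A).
Proof. by rewrite /hop; case: ifP. Qed.

Lemma hop_mem A c i : 0 < i < hop A c -> pad_add c i \in A :\ c.
Proof.
rewrite /hop; case: ifP => [cA|]; last by lia.
by have [_ _] := gapP c (negbT (setD11 c A)); apply.
Qed.

Lemma hop_memA A c i : i < hop A c -> pad_add c i \in A.
Proof.
case: i => [|i] ir; first by rewrite -hop_gt0.
by have := @hop_mem A c i.+1 ir; rewrite inE => /andP[].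
Qed.

(** Additive form of a push: one unit moves from c to the landing pad, in the
    vacuous case too. *)
Lemma push_count A c t :
  (t \in push A c) + (t == c) = (t \in A) + (t == landing A c) :> nat.
Proof.
have := landing_free A c; rewrite /push /landing; case: ifP => [cA|//].
rewrite !inE; set y := first_free _ _ => yA.
have [->|tc] := eqVneq t c.
  by move: yA; rewrite cA orbF addnC [c == y]eq_sym; case: eqVneq.
have [ty|ty] := eqVneq t y; last by rewrite /= addn0.
by move: yA; rewrite -ty tc /= => /negPf ->.
Qed.

Lemma card_push A c : #|push A c| = #|A|.
Proof.
have := landing_free A c; rewrite /push /landing; case: ifP => // cA yA.
by rewrite cardsU1 yA (cardsD1 c A) cA.
Qed.

(** Pushing is reversible: given the landing pad, the particle came from the
    first vacant pad met backwards. If two pads of departure were different,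
    the longer of the two hops would pass over the other one, which is vacant
    once the particle is lifted. *)
Lemma push_inj A A' c c' :
  push A c = push A' c' -> landing A c = landing A' c' -> A = A' /\ c = c'.
Proof.
move=> eA ey.
have eD : A :\ c = A' :\ c'.
  apply/setP => t; have := push_count A c t; have := push_count A' c' t.
  rewrite !inE eA ey.
  by case: (t == c); case: (t == c'); case: (t \in A); case: (t \in A'); lia.
suff ec : c = c'.
  split=> //; apply/setP => t; have := push_count A c t; have := push_count A' c' t.
  by rewrite eA ey ec; case: (t \in A); case: (t \in A'); lia.
wlog le : A A' c c' eA ey eD / hop A c <= hop A' c'.
  move=> H; case: (leqP (hop A c) (hop A' c')) => [|/ltnW] le; first exact: H le.
  by symmetry; apply: H le.
set n := hop A c in le *; set n' := hop A' c' in le *.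
have yE : pad_add c n = pad_add (pad_add c' (n' - n)) n.
  by rewrite pad_addD subnK // -!landingE.
have cE := @pad_add_inj n _ _ yE.
have [e|[lt|[n0 n0']]] : n' - n = 0 \/ (0 < n' - n < n') \/ n = 0 /\ 0 < n' by lia.
- by rewrite cE e.
- by have := hop_mem lt; rewrite -cE -eD !inE eqxx.
have cA' : c' \in A' by rewrite -hop_gt0.
have cA : c \notin A by rewrite -hop_gt0 -/n n0.
have yc : landing A' c' = c by rewrite -ey landingE -/n n0.
have : c \in push A' c' by rewrite /push cA' -yc /landing cA' setU11.
by rewrite -eA /push (negPf cA) (negPf cA).
Qed.

End Circle.

(** * One queue running around the circle *)

Section Queue.
Variable k : nat.
Implicit Types (A B X Y : {set 'I_k}) (c d t s u x y : 'I_k) (q : 'I_k -> nat).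

(** q t is the number of customers waiting after time t when X are the arrivals,
    Y the services and u is the only service that finds nobody; a customer
    may be served on arrival. As q u = 0, the equation at u forces a service
    without an arrival and nobody waiting just before. *)
Definition queue q X Y u : Prop :=
  q u = 0 /\ forall s, q (ordS s) + (ordS s \in Y)
                     = q s + (ordS s \in X) + (ordS s == u).

Lemma queue_idle q X Y u : queue q X Y u -> (u \in Y) && (u \notin X).
Proof.
case=> qu qS; have := qS (ord_pred u); rewrite ord_predK qu eqxx.
by case: (u \in Y); case: (u \in X); lia.
Qed.

(** Starting from u, where q vanishes, q - q' can only decrease, so q <= q'
    everywhere. But it drops by one at u', where q' vanishes, and q would be
    negative there. *)
Lemma queue_idle_unique q q' X Y u u' : queue q X Y u -> queue q' X Y u' -> u = u'.
Proof.
move=> [qu qS] [qu' qS']; apply/eqP/negPn/negP => uu'.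
have le : forall t, q t <= q' t.
  apply: (@pad_ind _ u) => [|s le]; first by rewrite qu.
  have := qS s; have := qS' s; have [-> |_] := eqVneq (ordS s) u; last by lia.
  by rewrite qu.
have := qS (ord_pred u'); have := qS' (ord_pred u'); have := le (ord_pred u').
by rewrite ord_predK eqxx eq_sym (negPf uu') qu'; lia.
Qed.

(** When the hop of the particle on c passes over the idle pad u, the used
    services move up to u and it is the landing pad that becomes idle. *)
Definition next_idle Y u c : 'I_k :=
  if offset c u < hop Y c then landing Y c else u.

(** The interchange step of the multiline queue. Removing the service at c makes
    one more customer wait, from c until either the idle service u or the new
    service absorbs the excess. Moving the arrival at the landing pad later
    makes one less customer wait until that arrival takes place. Adding and
    subtracting these two arcs gives the new queue length. *)
Lemma queue_push q X Y u c : queue q X Y u ->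
  exists q', queue q' (push X (landing Y c)) (push Y c) (next_idle Y u c).
Proof.
move=> Q; have [qu qS] := Q; have /andP[uY uX] := queue_idle Q.
set y := landing Y c; set n := hop Y c; set p := hop X y.
have yE : y = pad_add c n by rewrite /y landingE.
have nk : n <= k := hop_le Y c.
(* The first arc, a, runs from c to the idle pad or to y, whichever comes
   first; the second, b, is the hop of the arrival at y. *)
pose al := minn n (offset c u).
pose a t : nat := offset c t < al; pose b t : nat := offset y t < p.
have alk : al <= k by rewrite geq_min nk.
have aS s : a (ordS s) + (ordS s == pad_add c al) = a s + (ordS s == c) :> nat.
  exact: arc_step.
have bS s : b (ordS s) + (ordS s == landing X y) = b s + (ordS s == y) :> nat.
  by rewrite landingE; apply: arc_step; apply: hop_le.
have zu s : (s == pad_add c al) + (s == next_idle Y u c) = (s == y) + (s == u) :> nat.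
  rewrite /next_idle -/y -/n /al; have [lt|le] := ltnP (offset c u) n.
    by rewrite pad_add_offset addnC.
  by rewrite yE.
(* On b there is an arrival at each time, so a queue that is nonempty at y
   stays so; this is what makes the new length nonnegative. *)
have le_ba t : b t <= q t + a t.
  rewrite /b; case: ltnP => // lt; rewrite -(pad_add_offset y t).
  elim: (offset y t) lt => [|i IHi] ip.
    have yX : y \in X by apply: (hop_memA ip).
    have := qS (ord_pred y); rewrite ord_predK yX /=.
    (* The landing pad of Y can belong to Y only if Y is full. *)
    case: (boolP (y \in Y)) => [yY|_]; last by lia.
    have yc : y = c by have := landing_free Y c; rewrite -/y !inE yY andbT negbK => /eqP.
    have cY : c \in Y by rewrite -yc.
    suff -> : a y = 1 by lia.
    rewrite /a yc offset_same /al leq_min hop_gt0 cY lt0n offset_eq0.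
    by have /negPf -> : u != c by apply: contraNneq uX => ->; rewrite -yc.
  have := IHi (ltnW ip); rewrite [pad_add y i.+1]/= -/(pad_add y i).
  set s := pad_add y i => qas.
  have sX : ordS s \in X by apply: (hop_memA ip).
  have su : ordS s != u by apply: contraNneq uX => <-.
  have sy : ordS s != y.
    have := hop_le X y; rewrite -/p => pk; rewrite -offset_eq0.
    by rewrite -[ordS s]/(pad_add y i.+1) offset_pad_add //; lia.
  have := qS s; have := aS s; have := zu (ordS s).
  rewrite sX (negPf su) (negPf sy).
  case: (boolP (ordS s \in Y)) => [sY|_]; last by lia.
  by lia.
exists (fun t => q t + a t - b t); split; last first.
  move=> s; have := zu (ordS s); have := aS s; have := bS s; have := qS s.
  have := push_count Y c (ordS s); have := push_count X y (ordS s); rewrite -/y.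
  have := le_ba s; have := le_ba (ordS s).
  move: (a s) (a (ordS s)) (b s) (b (ordS s)) (q s) (q (ordS s)).
  by do ![move: (nat_of_bool _) => ?]; clear; lia.
rewrite /next_idle -/y -/n; have [lt|le] := ltnP (offset c u) n; last first.
  have := le_ba u; rewrite qu /a /al.
  by have -> : (offset c u < minn n (offset c u)) = false by lia.
have alE : al = offset c u by rewrite /al; lia.
(* Past the idle service there is a service at each time of the hop, so the
   queue stays empty up to y. *)
have q0 i : offset c u <= i < n -> q (pad_add c i) = 0.
  elim: i => [|i IHi].
    by rewrite leqn0 offset_eq0 => /andP[/eqP <-].
  move=> /andP[le_i lt_i]; have [e|ne] := eqVneq (offset c u) i.+1.
    by rewrite -e pad_add_offset.
  have /IHi q0 : offset c u <= i < n by lia.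
  have iY : pad_add c i.+1 \in Y by apply: (hop_memA lt_i).
  have iu : pad_add c i.+1 != u.
    by apply: contraNneq ne => <-; rewrite offset_pad_add //; lia.
  have := qS (pad_add c i); rewrite -[ordS _]/(pad_add c i.+1) iY (negPf iu) q0.
  by case: (_ \in X); lia.
have n0 : 0 < n by lia.
set s := pad_add c n.-1.
have sy : ordS s = y by rewrite yE -{1}(prednK n0).
have qs : q s = 0 by apply: q0; lia.
have as0 : a s = 0 by rewrite /a alE offset_pad_add; lia.
have cY : c \in Y by rewrite -hop_gt0.
have byX : b y = (y \in X) by rewrite /b offset_same hop_gt0.
have yY : (y \in Y) = (y == c).
  have := landing_free Y c; rewrite -/y !inE; case: eqVneq => [->|_] //=.
  by move/negPf.
have := qS s; have := aS s; rewrite sy as0 qs byX alE pad_add_offset yY.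
by lia.
Qed.

(** Pushing the used services agrees with pushing all services and then
    removing the new idle one: the two hops differ only if u is on the way, and
    then the used service stops at u. *)
Lemma push_idle Y u c : u \in Y -> push (Y :\ u) c = push Y c :\ next_idle Y u c.
Proof.
move=> uY; rewrite /next_idle.
have := landing_free Y c; have := landingE Y c.
have := @hop_mem _ Y c; have := hop_gt0 Y c.
set n := hop Y c; move=> n0 rY yE yY.
case: (boolP (c \in Y)) n0 => cY n0; last first.
  have -> : (offset c u < n) = false by lia.
  by rewrite /push !inE (negPf cY) andbF.
rewrite /landing cY in yY yE *; rewrite /push !inE cY andbT.
set y := first_free (Y :\ c) c in yY yE *.
have [cu|cu] := eqVneq c u.
  rewrite /= -cu offset_same n0 /= -/y.
  by rewrite setU1K.
rewrite /=; have DC : Y :\ u :\ c = Y :\ c :\ u.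
  by apply/setP => t; rewrite !inE andbCA.
rewrite DC; have uYc : u \in Y :\ c by rewrite !inE eq_sym cu.
have ou0 : 0 < offset c u by rewrite lt0n offset_eq0 eq_sym.
have [lt|le] := ltnP (offset c u) n.
  have -> : first_free (Y :\ c :\ u) c = u.
    rewrite (@first_free_unique _ _ _ (offset c u)) ?pad_add_offset ?setD11 // => i hi.
    rewrite in_setD1 rY ?andbT; last by lia.
    have ik : i < k by have := offset_lt c u; lia.
    by apply/eqP => iu; move: hi; rewrite -iu offset_pad_add // ltnn andbF.
  by rewrite setD1K ?setU1K.
have -> : first_free (Y :\ c :\ u) c = y.
  rewrite yE; apply: first_free_unique => // [|i hi].
    by rewrite in_setD1 -yE (negPf yY) andbF.
  rewrite in_setD1 rY // andbT; apply/eqP => iu; move: le.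
  have nk : n <= k := hop_le Y c.
  by rewrite -iu offset_pad_add; lia.
have yu : y != u by apply: contraNneq yY => ->.
apply/setP => t; rewrite !inE; have [->|_] := eqVneq t y; last by rewrite andbCA.
by rewrite yu.
Qed.

End Queue.

(** Generalizing the membership tests identifies those whose implicit arguments
    are equal only up to conversion, which lia treats as unrelated. *)
Ltac mem_lia := do ?[move: (nat_of_bool (_ \in _)) => ?]; lia.

Section Idle.
Variable k : nat.
Implicit Types (A B X Y : {set 'I_k}) (c d t s u x y : 'I_k) (q : 'I_k -> nat).

Definition upto u n A : nat := #|[set x in A | 0 < offset u x <= n]|.

Lemma upto0 u A : upto u 0 A = 0.
Proof.
rewrite /upto; apply/eqP; rewrite cards_eq0 -subset0.
by apply/subsetP => x; rewrite !inE; lia.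
Qed.

Lemma upto_ordS u s A :
  upto u (offset u (ordS s)) A + (ordS s == u) * #|A| = upto u (offset u s) A + (ordS s \in A).
Proof.
have := offset_ordS u s; have [eu [es e0]|neu eS] := eqVneq (ordS s) u.
  rewrite eu offset_same upto0 mul1n add0n (cardsD1 u A) addnC; congr (_ + _).
  apply: eq_card => x; rewrite !inE -(offset_eq0 u x) es.
  by rewrite andbC lt0n; have := offset_lt u x; case: eqP => //= ne; case: (x \in A) => //; lia.
rewrite mul0n addn0 /upto (cardsD1 (ordS s)) addnC; congr (_ + _); last first.
  by rewrite !inE eS leqnn !andbT.
apply: eq_card => x; rewrite !inE eS -(inj_eq (@offset_inj _ u)) eS.
by case: (x \in A); rewrite ?andbF //=; lia.
Qed.

(** Decidable form of [queue]: the queue is empty at u, so its length at t can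
    only be the number of arrivals minus that of services since u. *)
Definition idle X Y u : bool :=
  (#|Y| == #|X|.+1) && [forall t, upto u (offset u t) Y <= upto u (offset u t) X].

Lemma idleP X Y u : reflect (exists q, queue q X Y u) (idle X Y u).
Proof.
apply: (iffP andP) => [[/eqP cYX /forallP leYX]|[q [qu qS]]].
  exists (fun t => upto u (offset u t) X - upto u (offset u t) Y).
  split=> [|s] /=; first by rewrite !offset_same !upto0.
  have := upto_ordS u s X; have := upto_ordS u s Y.
  have := leYX s; have := leYX (ordS s); rewrite cYX.
  by case: (ordS s == u); rewrite ?mul1n ?mul0n /=; mem_lia.
have qE : forall t, q t + upto u (offset u t) Y == upto u (offset u t) X.
  apply: (@pad_ind _ u) => [|s /eqP qs]; first by rewrite qu !offset_same !upto0.
  have := qS s; have := upto_ordS u s X; have := upto_ordS u s Y.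
  have [->|_] := eqVneq (ordS s) u; first by rewrite qu !offset_same !upto0.
  by rewrite mul0n; mem_lia.
split; last by apply/forallP => t; rewrite -(eqP (qE t)) leq_addl.
have := qS (ord_pred u); have := eqP (qE (ord_pred u)).
have := upto_ordS u (ord_pred u) X; have := upto_ordS u (ord_pred u) Y.
by rewrite ord_predK eqxx !offset_same !upto0 qu !mul1n /=; mem_lia.
Qed.

(** The cycle lemma: arrivals minus services drop by one in each turn, so there
    is exactly one pad per turn where their running count H reaches a new
    minimum. *)
Lemma idle_exists X Y : #|Y| = #|X|.+1 -> exists u, idle X Y u.
Proof.
move=> cYX; have /card_gt0P[o _] : 0 < #|Y| by rewrite cYX.
pose H t := k + upto o (offset o t) X - upto o (offset o t) Y.
have HS s : H (ordS s) + (ordS s \in Y) = H s + (ordS s \in X) + (ordS s == o).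
  have le A t : upto o (offset o t) A <= k by rewrite -[X in _ <= X]card_ord max_card.
  have := upto_ordS o s X; have := upto_ordS o s Y; rewrite cYX /H.
  have := le Y s; have := le Y (ordS s).
  by case: (ordS s == o); rewrite ?mul1n ?mul0n /=; mem_lia.
(* Lexicographic minimum: the first pad, from o on, where H is minimal. *)
case: (arg_minnP (fun t => H t * k + offset o t) (erefl : predT o)) => u _ umin.
exists u; apply/idleP.
have le t : H u + (offset o t < offset o u) <= H t.
  have := umin t isT; have := offset_lt o t; have := offset_lt o u.
  by case: ltnP => _; nia.
exists (fun t => H t - H u - (offset o t < offset o u)); split; first by lia.
move=> s; have := HS s; have := le s; have := le (ordS s).
have := arc_step o s (ltnW (offset_lt o u)); rewrite pad_add_offset.
by rewrite /=; mem_lia.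
Qed.

End Idle.

(** * The pads held by the nastiest frogs *)

Section Frogs.
Variable k : nat.
Implicit Types (A B P : {set 'I_k}) (c i x : 'I_k) (s : frog_state k) (F : frog_arrangement k).

Definition nasty_pads F j : {set 'I_k} := [set F i | i : 'I_k & i < j].

Definition calm_pads s j : {set 'I_k} :=
  [set position s i | i : 'I_k & (i < j) && (i \notin agitated s)].

(** The pads that the j nastiest frogs will finally occupy, predicted from a
    state in the middle of the leaps: if the agitated frog i is among them, the
    chain of evictions it starts ends, as far as these frogs are concerned, at
    the first pad that none of the calm ones holds. *)
Definition settled s j : {set 'I_k} :=
  let P := calm_pads s j in
  if nastiest (agitated s) is Some i
  then if i < j then first_free P (position s i) |: P else P
  else P.

(** Invariant of the leaps: a leap evicts at most one frog because calm frogs do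
    not share pads. *)
Definition solitary s : Prop :=
  {in ~: agitated s &, injective (position s)} /\
  (agitated s = set0 \/ exists i, agitated s = [set i]).

Lemma nastiest0 : nastiest (set0 : {set 'I_k}) = None.
Proof. by have := nastiestP (set0 : {set 'I_k}); case: nastiest => // i []; rewrite inE. Qed.

Lemma nastiest1 i : nastiest [set i] = Some i.
Proof.
have := nastiestP [set i]; case: nastiest => [i' []|/setP/(_ i)].
  by rewrite inE => /eqP ->.
by rewrite !inE eqxx.
Qed.

(** The frog i < j passes only over pads of nastier frogs. If it evicts a frog
    b < j, the calm pads are the same as before and the search goes on from the
    pad of b; otherwise it has found the predicted pad. *)
Lemma settled_leap s j : solitary s -> solitary (leap s) /\ settled (leap s) j = settled s j.
Proof.
move=> solitary_s; have [inj_s [A0|[i Ai]]] := solitary_s.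
  by rewrite /leap A0 nastiest0.
set p := position s in inj_s *.
have inj_p a b : a != i -> b != i -> p a = p b -> a = b.
  by move=> ai bi; apply: inj_s; rewrite Ai !inE.
have [] := leap_lengthP p i; rewrite -/(leap_target p i).
set n := leap_length p i; set t := leap_target p i.
move=> /andP[n0 nk] /negP tfree between.
have tE : t = pad_add (p i) n by [].
set p' : {ffun 'I_k -> 'I_k} := [ffun a => if a == i then t else p a].
have p'i : p' i = t by rewrite ffunE eqxx.
have p'ne a : a != i -> p' a = p a by move=> ai; rewrite ffunE (negPf ai).
have leapE : leap s = FrogState p' [set a | (a != i) && (p a == t)].
  by rewrite /leap Ai nastiest1 setDv set0U.
have [|nob] := pickP (fun a => (a != i) && (p a == t)); last first.
  (* the landing pad was vacant *)
  have A0 : agitated (leap s) = set0.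
    by rewrite leapE; apply/setP => a; rewrite !inE nob.
  have calm' : calm_pads (leap s) j = if i < j then t |: calm_pads s j else calm_pads s j.
    rewrite /calm_pads A0 leapE /= Ai -/p.
    apply/setP => x; apply/imsetP/idP => [[a]|].
      rewrite !inE andbT => aj ->; have [ai|ai] := eqVneq a i.
        by rewrite ai p'i -ai aj setU11.
      suff xin : p' a \in [set p b | b : 'I_k & (b < j) && (b \notin [set i])].
        by case: ifP => // _; rewrite inE xin orbT.
      by rewrite p'ne //; apply: imset_f; rewrite !inE aj ai.
    have old : x \in [set p b | b : 'I_k & (b < j) && (b \notin [set i])] ->
        exists2 a : 'I_k, a \in [set b : 'I_k | (b < j) && (b \notin set0)] & x = p' a.
      case/imsetP => a; rewrite !inE => /andP[aj ai] ->.
      by exists a; rewrite ?p'ne // !inE aj.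
    case: ifP => [ij|//]; rewrite in_setU1 => /orP[/eqP ->|/old//].
    by exists i; rewrite ?p'i // !inE ij.
  split.
    split; last by left.
    rewrite A0 leapE /= => a b _ _.
    have [->|ai] := eqVneq a i; have [->|bi] := eqVneq b i => //.
    - by rewrite p'i p'ne // => tb; have := nob b; rewrite bi -tb eqxx.
    - by rewrite p'i p'ne // => tb; have := nob a; rewrite ai tb eqxx.
    - by rewrite !p'ne //; apply: inj_p.
  rewrite /settled A0 nastiest0 Ai nastiest1 calm'; case: ifP => // ij.
  congr (_ |: _); rewrite tE; apply/esym/first_free_unique => // [|y hy].
    rewrite -tE; apply/imsetP => -[a]; rewrite !inE Ai inE => /andP[aj ai] ta.
    by have := nob a; rewrite ai ta eqxx.
  have /existsP[a /andP[ai /eqP <-]] := between y hy.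
  by apply: imset_f; rewrite !inE Ai inE (ltn_trans ai ij) neq_ltn ai.
(* the landing pad was occupied by the frog b *)
move=> b /andP[bi /eqP bt].
have Ab : agitated (leap s) = [set b].
  rewrite leapE; apply/setP => a; rewrite !inE; apply/andP/eqP => [[ai /eqP at_]|->].
    by apply: inj_p => //; rewrite at_ bt.
  by rewrite bt.
have ib : i < b.
  have [//|lt_bi|/val_inj e] := ltngtP i b; last by rewrite e eqxx in bi.
  by case: tfree; apply/existsP; exists b; rewrite lt_bi /= bt.
have calm' : calm_pads (leap s) j =
    if (i < j) && (j <= b) then t |: calm_pads s j else calm_pads s j.
  rewrite /calm_pads Ab leapE /= Ai -/p.
  apply/setP => x; apply/imsetP/idP => [[a]|].
    rewrite !inE => /andP[aj ab] ->; have [ai|ai] := eqVneq a i.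
      rewrite -ai aj /= ai p'i; case: leqP => bj; first by rewrite setU11.
      by rewrite -bt; apply: imset_f; rewrite !inE bj bi.
    suff xin : p' a \in [set p b | b : 'I_k & (b < j) && (b \notin [set i])].
      by case: ifP => // _; rewrite inE xin orbT.
    by rewrite p'ne //; apply: imset_f; rewrite !inE aj ai.
  have old : x \in [set p b | b : 'I_k & (b < j) && (b \notin [set i])] -> x != t ->
      exists2 a : 'I_k, a \in [set a : 'I_k | (a < j) && (a \notin [set b])] & x = p' a.
    case/imsetP => a; rewrite !inE => /andP[aj ai] -> pat.
    exists a; rewrite ?p'ne // !inE aj /=.
    by apply: contraNneq pat => ->; rewrite bt.
  have new : i < j ->
      exists2 a : 'I_k, a \in [set a : 'I_k | (a < j) && (a \notin [set b])] & t = p' a.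
    by move=> ij; exists i; rewrite ?p'i // !inE ij eq_sym.
  have [->|xt] := eqVneq x t; last first.
    by case: ifP => _; rewrite ?in_setU1 ?(negPf xt) /= => /old; apply.
  case: ifP => [/andP[ij _] _|]; first exact: new.
  move=> nij /imsetP[a]; rewrite !inE => /andP[aj ai] ta.
  have ab : a = b by apply: inj_p => //; rewrite -ta bt.
  by apply: new; apply: ltn_trans ib _; rewrite -ab.
have between' : i < j -> forall y, 0 < y < n -> pad_add (p i) y \in calm_pads s j.
  move=> ij y hy; have /existsP[a /andP[ai /eqP <-]] := between y hy.
  by apply: imset_f; rewrite !inE Ai inE (ltn_trans ai ij) neq_ltn ai.
split.
  split; last by right; exists b.
  rewrite Ab leapE /= => a a'; rewrite !inE => ab a'b.
  have tne c : c != b -> c != i -> p c != t.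
    by move=> cb ci; apply: contraNneq cb => pc; apply/eqP/inj_p; rewrite // bt.
  have [->|ai] := eqVneq a i; have [->|a'i] := eqVneq a' i => //.
  - by rewrite p'i p'ne // => ta; have := tne _ a'b a'i; rewrite -ta eqxx.
  - by rewrite p'i p'ne // => ta; have := tne _ ab ai; rewrite ta eqxx.
  - by rewrite !p'ne //; apply: inj_p.
rewrite /settled Ab !Ai !nastiest1 calm' /=.
have p'b : position (leap s) b = t by rewrite leapE /= p'ne.
rewrite p'b; have [ij|ji] := ltnP i j; last first.
  by have -> : (b < j) = false by lia.
have [bj|jb] /= := ltnP b j.
  have [z zfree] : exists z, z \notin calm_pads s j.
    apply/existsP; rewrite -negb_forall; apply/negP => /forallP full.
    have : #|[set: 'I_k]| <= #|p @: (~: [set i])|.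
      apply/subset_leq_card/subsetP => x _; have /imsetP[a] := full x.
      by rewrite !inE Ai inE => /andP[_ ai] ->; apply: imset_f; rewrite !inE.
    have := leq_imset_card p (~: [set i]); have := cardsC [set i].
    by rewrite cards1 -cardsT cardsT; lia.
  congr (_ |: _); rewrite -/p tE (first_free_skip zfree) // => y /andP[y0 yn].
  have [->|yn'] := eqVneq y n; last by apply: between'; lia.
  by rewrite -tE -bt; apply: imset_f; rewrite !inE Ai inE bj bi.
congr (_ |: _); rewrite -/p tE; apply/esym/first_free_unique => //; last exact: between'.
rewrite -tE; apply/imsetP => -[a]; rewrite !inE Ai inE => /andP[aj ai] ta.
have ab : a = b by apply: inj_p => //; rewrite -ta bt.
by move: aj; rewrite ab; lia.
Qed.

(** The prediction is constant along the leaps. At the start it is the pushed set,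
    by the definition of a push; at the end nothing is left to predict. *)
Lemma nasty_pads_act F c j :
  nasty_pads (frog_act (fun x => x) F c) j = push (nasty_pads F j) c.
Proof.
set s0 := initial_state (fun x : 'I_k => x) F c.
have A0 : agitated s0 = [set (F^-1)%g c].
  by apply/setP => a; rewrite !inE (canF_eq (permK F)).
have [fin_solitary finE] : solitary (final_state (fun x => x) F c) /\
    settled (final_state (fun x => x) F c) j = settled s0 j.
  have solitary0 : solitary s0.
    split; last by right; exists ((F^-1)%g c).
    by move=> a b _ _ /=; rewrite !ffunE; apply: perm_inj.
  have iterE n : solitary (iter n (@leap k) s0) /\ settled (iter n (@leap k) s0) j = settled s0 j.
    by elim: n => //= n [solitary_n <-]; apply: settled_leap.
  exact: iterE.
have -> : nasty_pads (frog_act (fun x => x) F c) j = settled (final_state (fun x => x) F c) j.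
  rewrite /settled final_state_calm nastiest0 /calm_pads final_state_calm.
  apply/setP => x; apply/imsetP/imsetP => -[a]; rewrite !inE.
    by move=> aj ->; exists a; rewrite ?inE ?aj // permE.
  by rewrite andbT => aj ->; exists a; rewrite ?inE ?aj // permE.
rewrite finE /settled A0 nastiest1.
have calmE : calm_pads s0 j = nasty_pads F j :\ c.
  rewrite /calm_pads A0; apply/setP => x; rewrite in_setD1.
  apply/imsetP/andP => [[a]|[xc /imsetP[a]]]; rewrite !inE /=.
    move=> /andP[aj ac] ->; rewrite ffunE; split; last by apply: imset_f; rewrite inE.
    by apply: contraNneq ac => <-; rewrite permK.
  move=> aj xa; exists a; rewrite ?ffunE // !inE aj /=.
  by apply: contraNneq xc => ac; rewrite xa ac permKV.
have cE : (c \in nasty_pads F j) = ((F^-1)%g c < j).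
  apply/imsetP/idP => [[a]|cj]; first by rewrite inE => aj ->; rewrite permK.
  by exists ((F^-1)%g c); rewrite ?inE ?permKV.
rewrite calmE /push cE /= ffunE permKV; case: ifP => // cj.
by apply/setP => x; rewrite in_setD1; case: eqP => // ->; rewrite cE cj.
Qed.

Lemma card_nasty_pads F j : j <= k -> #|nasty_pads F j| = j.
Proof.
move=> jk; rewrite card_imset; last exact: perm_inj.
exact: card_ord_lt.
Qed.

Lemma nasty_padsS F m (mk : m < k) :
  nasty_pads F m.+1 = F (Ordinal mk) |: nasty_pads F m.
Proof.
apply/setP => x; rewrite in_setU1; apply/imsetP/orP => [[i]|[/eqP ->|/imsetP[i]]].
- rewrite inE ltnS leq_eqVlt => /orP[/eqP im|im] ->.
    by left; rewrite (_ : i = Ordinal mk) //; apply: val_inj.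
  by right; apply: imset_f; rewrite inE.
- by exists (Ordinal mk); rewrite ?inE /=.
- by rewrite inE => im ->; exists i; rewrite ?inE // ltnS ltnW.
Qed.

End Frogs.

(** * Stationary weights of a random composition of maps *)

Section RandomMaps.
Local Open Scope ring_scope.
Variable R : realFieldType.

Definition fiber_mass (T U : finType) (f : T -> U) (d : T -> R) (y : U) : R :=
  \sum_(x | f x == y) d x.

Lemma sum_fiber_mass (T U : finType) (f : T -> U) (d : T -> R) (Q : pred U) :
  \sum_(y | Q y) fiber_mass f d y = \sum_(x | Q (f x)) d x.
Proof.
rewrite [RHS](partition_big f Q) //; apply: eq_bigr => y Qy.
by apply: eq_bigl => x; case: eqP => [->|]; rewrite ?Qy ?andbF.
Qed.

Variables (P C : finType) (G : P -> C -> P).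

(** Stationarity, up to the factor #|C|, for the chain that applies G with a
    uniformly random symbol; d may be signed and need not have total 1. *)
Definition balanced (d : P -> R) : Prop :=
  forall y, \sum_(c : C) fiber_mass (G^~ c) d y = #|C|%:R * d y.

Definition mass (d : P -> R) : R := \sum_x `|d x|.

Lemma mass_fiber_le (f : P -> P) d : mass (fiber_mass f d) <= mass d.
Proof.
rewrite /mass -(sum_fiber_mass f (fun x => `|d x|) predT).
by apply: ler_sum => y _; apply: ler_norm_sum.
Qed.

(** Merging states can only cancel mass, yet d is the average of its images
    under the symbols, so none of them may lose any; by induction the same holds
    for words. *)
Lemma balanced_mass d w : (0 < #|C|)%N -> balanced d ->
  mass d <= mass (fiber_mass (fun x => foldl G x w) d).
Proof.
move=> C0 inv; elim: w => [|c0 w IHw].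
  apply: ler_sum => y _; rewrite /fiber_mass.
  by rewrite (big_pred1 y) // => x; rewrite /= eq_sym.
pose D c := fiber_mass (fun x => foldl G x (c :: w)) d.
have avg y : \sum_c D c y = #|C|%:R * fiber_mass (fun x => foldl G x w) d y.
  rewrite [in RHS]/fiber_mass big_distrr /=.
  rewrite (eq_bigr (fun z => \sum_c fiber_mass (G^~ c) d z)) => [|z _]; last by rewrite inv.
  by rewrite exchange_big; apply: eq_bigr => c _; rewrite sum_fiber_mass.
have le_total : #|C|%:R * mass d <= \sum_c mass (D c).
  apply: le_trans (_ : #|C|%:R * mass (fiber_mass (fun x => foldl G x w) d) <= _).
    by rewrite ler_wpM2l ?ler0n.
  rewrite /mass big_distrr exchange_big /=; apply: ler_sum => y _.
  rewrite -[X in X * _]ger0_norm ?ler0n // -normrM -avg; exact: ler_norm_sum.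
move: le_total; rewrite mulr_natl -sumr_const (bigD1 c0) //= [leRHS](bigD1 c0) //= => le_total.
have le_rest : \sum_(c | c != c0) mass (D c) <= \sum_(c | c != c0) mass d.
  by apply: ler_sum => c _; apply: mass_fiber_le.
by rewrite -(lerD2r (\sum_(c | c != c0) mass d)) (le_trans le_total) // lerD2l.
Qed.

(** Apply the synchronizing word to the difference of the two weights: all of it
    lands on p0, where it adds up to 0. *)
Lemma balanced_unique (V : {set P}) d d' w p0 : (0 < #|C|)%N ->
  balanced d -> balanced d' -> \sum_x d x = \sum_x d' x ->
  (forall x, x \notin V -> d x = 0) -> (forall x, x \notin V -> d' x = 0) ->
  {in V, forall x, foldl G x w = p0} -> d =1 d'.
Proof.
move=> C0 inv inv' tot d0 d'0 sync.
pose e x := d x - d' x.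
have inv_e : balanced e.
  move=> y; rewrite mulrBr -inv -inv' -sumrB; apply: eq_bigr => c _.
  by rewrite /fiber_mass sumrB.
have e_out x : x \notin V -> e x = 0 by move=> xV; rewrite /e d0 ?d'0 ?subrr.
have e_tot : \sum_x e x = 0 by rewrite sumrB tot subrr.
have : mass e <= 0.
  apply: le_trans (balanced_mass w C0 inv_e) _.
  rewrite /mass big1 // => y _; apply/eqP; rewrite normr_eq0; apply/eqP.
  rewrite /fiber_mass (bigID (mem V)) /= addrC big1 ?add0r => [|x /andP[_ /e_out //]].
  have [<-|ne] := eqVneq p0 y.
    rewrite -{}[RHS]e_tot [RHS](bigID (mem V)) /= addrC [X in _ = X + _]big1 ?add0r //.
    by apply: eq_bigl => x; case: (boolP (x \in V)) => xV; rewrite ?andbF // sync ?eqxx.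
  by rewrite big1 // => x /andP[/eqP + xV]; rewrite sync // => py; rewrite py eqxx in ne.
move=> e0 x; apply/eqP; rewrite -subr_eq0 -normr_le0; apply: le_trans e0.
by rewrite /mass (bigD1 x) //= lerDl sumr_ge0.
Qed.

(** If the chain lifts to a larger space on which each step, together with an
    output symbol, is reversible, then the uniform weight upstairs is
    stationary and so is its image. *)
Lemma lift_balanced (Z : finType) (V : {set Z}) (f : Z -> P) (Phi : Z * C -> Z * C) :
  {in setX V setT &, injective Phi} ->
  (forall z c, z \in V -> (Phi (z, c)).1 \in V /\ f (Phi (z, c)).1 = G (f z) c) ->
  balanced (fun p => #|[set z in V | f z == p]|%:R).
Proof.
move=> inj_Phi stepP y.
set D := setX V setT in inj_Phi.
pose E := setX [set z in V | f z == y] [set: C].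
have PhiD : Phi @: D = D.
  apply/eqP; rewrite eqEcard card_in_imset // leqnn andbT.
  apply/subsetP => _ /imsetP[[z c] + ->]; rewrite !inE andbT => zV.
  by have [] := stepP z c zV; rewrite andbT.
have -> : #|C|%:R * #|[set z in V | f z == y]|%:R = #|E|%:R :> R.
  by rewrite cardsX cardsT mulnC natrM.
have -> : #|E| = #|[set zc in D | G (f zc.1) zc.2 == y]|.
  transitivity #|Phi @: [set zc in D | G (f zc.1) zc.2 == y]|; last first.
    by apply: card_in_imset; apply: sub_in2 inj_Phi => zc; rewrite inE => /andP[].
  apply: eq_card => zc; rewrite !inE; apply/idP/imsetP.
    rewrite andbT => /andP[zV /eqP fz].
    have : zc \in Phi @: D by rewrite PhiD !inE zV.
    case/imsetP => -[z c] zcD zcE; exists (z, c) => //.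
    move: zcD; rewrite !inE /= andbT => zV'; rewrite zV' /=.
    by have [_ <-] := stepP z c zV'; rewrite -zcE fz.
  case=> -[z c]; rewrite !inE /= andbT => /andP[zV fz] ->.
  by have [-> ->] := stepP z c zV; rewrite fz.
rewrite -sum1dep_card natr_sum.
transitivity (\sum_(c : C) \sum_(z | (z \in V) && (G (f z) c == y)) 1 : R).
  apply: eq_bigr => c _; rewrite /fiber_mass.
  rewrite [RHS](partition_big f (fun p => G p c == y)) => [|z /andP[]//].
  apply: eq_bigr => p /eqP Gp; rewrite -sum1dep_card natr_sum.
  apply: eq_bigl => z; case: eqP => [->|_]; rewrite ?andbF // Gp eqxx !andbT //.
rewrite pair_big_dep /= (reindex (fun zc : Z * C => (zc.2, zc.1))) /=; last first.
  by exists (fun cz => (cz.2, cz.1)) => -[].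
by apply: eq_bigl => -[z c]; rewrite !inE /= andbT.
Qed.

End RandomMaps.

(** * Laws of the occupied pads *)

Section LiftedLaw.
Local Open Scope ring_scope.
Variables (R : realFieldType) (P C : finType) (G : P -> C -> P).

(** Identification of a stationary law: the image of the uniform law of a
    reversible lift is stationary, and a synchronizing word makes it the only
    one. *)
Lemma lifted_law (d : P -> R) (VP : {set P}) w p0
    (Z : finType) (V : {set Z}) (f : Z -> P) (Phi : Z * C -> Z * C) :
  (0 < #|C|)%N -> (0 < #|V|)%N ->
  balanced G d -> \sum_p d p = 1 -> (forall p, p \notin VP -> d p = 0) ->
  {in VP, forall p, foldl G p w = p0} -> {in V, forall z, f z \in VP} ->
  {in setX V setT &, injective Phi} ->
  (forall z c, z \in V -> (Phi (z, c)).1 \in V /\ f (Phi (z, c)).1 = G (f z) c) ->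
  forall p, d p = #|[set z in V | f z == p]|%:R / #|V|%:R.
Proof.
move=> C0 V0 inv tot out sync fV inj_Phi stepP.
apply: (balanced_unique (V := VP) (w := w) (p0 := p0) C0 inv) => //.
- move=> y; have := lift_balanced R inj_Phi stepP y; rewrite mulrA => <-.
  by rewrite big_distrl; apply: eq_bigr => c _; rewrite [RHS]big_distrl.
- have -> : \sum_p d p = #|V|%:R / #|V|%:R.
    by rewrite tot divff // pnatr_eq0 -lt0n.
  rewrite -big_distrl /= -natr_sum -sum1_card (partition_big f predT) //=.
  by congr (_%:R / _); apply: eq_bigr => p _; rewrite sum1dep_card.
- move=> p pVP; apply/eqP; rewrite mulf_eq0 pnatr_eq0 cards_eq0; apply/orP; left.
  apply/eqP/setP => z; rewrite !inE; apply/negP => /andP[zV /eqP fz].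
  by move: pVP; rewrite -fz fV.
Qed.

Lemma stationary_fiber k (W : 'I_k -> C) (mu : frog_arrangement k -> R)
    (f : frog_arrangement k -> P) :
  (0 < #|C|)%N -> stationary (frog_kernel R W) mu ->
  (forall F c, f (frog_act W F c) = G (f F) c) ->
  balanced G (fiber_mass f mu).
Proof.
move=> C0 [_ bal] fG y.
have C0' : #|C|%:R != 0 :> R by rewrite pnatr_eq0 -lt0n.
have bal' F' : \sum_c fiber_mass (fun F => frog_act W F c) mu F' = #|C|%:R * mu F'.
  rewrite -bal big_distrr /=.
  rewrite (eq_bigr _ (fun c _ => big_mkcond _ _)) exchange_big /=; apply: eq_bigr => F _.
  rewrite /frog_kernel mulrCA [#|C|%:R * _]mulrC divfK // -sum1dep_card natr_sum mulr_sumr.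
  by rewrite -big_mkcond; apply: eq_bigr => c _; rewrite mulr1.
rewrite [in RHS]/fiber_mass big_distrr /=.
rewrite -(eq_bigr _ (fun F' _ => bal' F')) exchange_big /=; apply: eq_bigr => c _.
rewrite {1}/fiber_mass (sum_fiber_mass f mu (fun p => G p c == y)).
rewrite (sum_fiber_mass _ mu (fun F' => f F' == y)).
by apply: eq_bigl => F; rewrite fG.
Qed.

End LiftedLaw.

Section Sync.
Variable k : nat.
Implicit Types (A B X Y S T : {set 'I_k}) (c u : 'I_k).

Definition sweep n : seq 'I_k := take n (enum 'I_k).

Lemma card_foldl_push w A : #|foldl (@push k) A w| = #|A|.
Proof. by elim: w A => //= c w IHw A; rewrite IHw card_push. Qed.

Lemma card_ge n : n <= k -> #|[set x : 'I_k | n <= x]| = k - n.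
Proof.
move=> nk; have := cardsC [set x : 'I_k | x < n]; rewrite card_ord card_ord_lt //.
have -> : ~: [set x : 'I_k | x < n] = [set x : 'I_k | n <= x].
  by apply/setP => x; rewrite !inE -leqNgt.
lia.
Qed.

(** After the symbols 0, ..., n - 1 all particles are on pads from n on: a
    particle on n can still hop forward without wrapping around as long as
    there are more than #|A| pads from n on. *)
Lemma sweep_push A : foldl (@push k) A (sweep (k - #|A|)) = [set x : 'I_k | k - #|A| <= x].
Proof.
have cA : #|A| <= k by rewrite -[X in _ <= X]card_ord max_card.
suff sub n : n <= k - #|A| -> foldl (@push k) A (sweep n) \subset [set x : 'I_k | n <= x].
  by apply/eqP; rewrite eqEcard sub // card_ge ?card_foldl_push ?leq_subr //; lia.
elim: n => [|n IHn] lt_n; first by apply/subsetP => x; rewrite inE.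
have nk : n < k by lia.
pose c := Ordinal nk.
have -> : sweep n.+1 = rcons (sweep n) c.
  by rewrite /sweep (take_nth c) ?size_enum_ord // (nth_ord_enum c c).
rewrite foldl_rcons; have {IHn} := IHn (ltnW lt_n).
have := card_foldl_push (sweep n) A; set B := foldl _ _ _ => cB /subsetP leB.
rewrite /push; case: ifP => cinB; last first.
  apply/subsetP => x xB; have := leB x xB; rewrite !inE leq_eqVlt => /orP[/eqP nx|//].
  by move: cinB; rewrite (_ : c = x) ?xB //; apply: val_inj.
have /subsetPn[z] : ~~ ([set x : 'I_k | n.+1 <= x] \subset B :\ c).
  apply/negP => /subset_leq_card; rewrite card_ge //.
  have := cardsD1 c B; rewrite cinB cB => cA' le; move: le lt_n; rewrite cA'.
  by move: #|_ :\ _| => b; lia.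
rewrite inE => nz zB; have [/andP[g0 gk] gB gltB] := gapP c zB.
have zE : z = pad_add c (z - n).
  by apply: ord_inj; rewrite val_pad_add /= subnKC ?modn_small // ltnW.
have le_g : gap (B :\ c) c <= z - n.
  rewrite leqNgt; apply/negP => lt; have := gltB (z - n).
  by rewrite -zE (negPf zB) lt subn_gt0 nz => /(_ isT).
apply/subsetP => x; rewrite in_setU1 => /orP[/eqP ->|].
  rewrite inE /first_free val_pad_add /= modn_small; first by lia.
  by have := ltn_ord z; lia.
rewrite !inE => /andP[xc /leB]; rewrite inE leq_eqVlt => /orP[/eqP nx|//].
by move: xc; rewrite (_ : x = c) ?eqxx //; apply: val_inj.
Qed.

Definition push2 (p : {set 'I_k} * {set 'I_k}) c := (push p.1 c, push p.2 c).

Lemma foldl_push2 p w : foldl push2 p w = (foldl (@push k) p.1 w, foldl (@push k) p.2 w).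
Proof. by elim: w p => [|c w IHw] p /=; [case: p|rewrite IHw]. Qed.

(** A first sweep brings the larger set to a known position, where it stays known
    while a second sweep takes care of the smaller one. *)
Lemma sync_push2 m n : exists w p0,
  forall p : {set 'I_k} * {set 'I_k}, #|p.1| = m -> #|p.2| = n -> foldl push2 p w = p0.
Proof.
exists (sweep (k - n) ++ sweep (k - m)).
exists ([set x : 'I_k | k - m <= x], foldl (@push k) [set x : 'I_k | k - n <= x] (sweep (k - m))).
move=> p cm cn; rewrite foldl_push2 !foldl_cat -cn sweep_push.
by rewrite -{1}cm -{1}(card_foldl_push (sweep (k - #|p.2|)) p.1) sweep_push card_foldl_push cm.
Qed.

End Sync.

Section Laws.
Local Open Scope ring_scope.
Variables (R : realFieldType) (k : nat) (mu : frog_arrangement k -> R).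
Hypothesis hmu : stationary (frog_kernel R (fun x : 'I_k => x)) mu.
Implicit Types (S T X Y : {set 'I_k}) (u : 'I_k).

Lemma nasty_pads_uniform m S : (0 < k)%N -> (m <= k)%N -> #|S| = m ->
  fiber_mass (fun F => nasty_pads F m) mu S = ('C(k, m)%:R)^-1.
Proof.
move=> k0 mk cS.
pose V := [set A : {set 'I_k} | #|A| == m].
have cV : #|V| = 'C(k, m) by rewrite card_draws card_ord.
rewrite (@lifted_law R _ _ (@push k) _ V (sweep k (k - m)) [set x : 'I_k | (k - m <= x)%N] _ V id
          (fun Ac => (push Ac.1 Ac.2, landing Ac.1 Ac.2))).
- rewrite (_ : [set z in V | z == S] = [set S]) ?cards1 ?mul1r ?cV //.
  by apply/setP => A; rewrite !inE andbC; case: eqP => // ->; rewrite cS eqxx.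
- by rewrite card_ord.
- by rewrite cV bin_gt0.
- apply: stationary_fiber hmu _; first by rewrite card_ord.
  by move=> F c; apply: nasty_pads_act.
- by rewrite (sum_fiber_mass _ _ predT) /=; case: hmu => -[].
- move=> A AV; rewrite /fiber_mass big_pred0 // => F; apply/negP => /eqP FA.
  by move: AV; rewrite inE -FA card_nasty_pads ?eqxx.
- by move=> A; rewrite inE => /eqP <-; apply: sweep_push.
- by [].
- by move=> [A c] [A' c'] _ _ /= [e1 e2]; have [-> ->] := push_inj e1 e2.
- by move=> A c; rewrite !inE /= card_push.
Qed.

(** The two-row chain has one state for each pair of rows, because the rows
    determine the idle service; above a given value of the nested pair, only
    the top row is free. *)
Lemma nasty_pads2_law m T u : (m < k)%N -> #|T| = m.+1 -> u \in T ->
  fiber_mass (fun F => (nasty_pads F m, nasty_pads F m.+1)) mu (T :\ u, T)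
  = #|[set X | idle X T u]|%:R / ('C(k, m) * 'C(k, m.+1))%:R.
Proof.
move=> mk cT uT.
pose V := [set z : {set 'I_k} * {set 'I_k} * 'I_k |
            (#|z.1.1| == m) && idle z.1.1 z.1.2 z.2].
pose f (z : {set 'I_k} * {set 'I_k} * 'I_k) := (z.1.2 :\ z.2, z.1.2).
have idle_unique z z' : z \in V -> z' \in V -> z.1 = z'.1 -> z = z'.
  case: z z' => [[X Y] v] [[X' Y'] v']; rewrite !inE /=.
  move=> /andP[_ /idleP[q Q]] /andP[_ /idleP[q' Q']] [eX eY].
  by rewrite eX eY in Q *; rewrite (queue_idle_unique Q Q').
have cV : #|V| = ('C(k, m) * 'C(k, m.+1))%N.
  have draws n : 'C(k, n) = #|[set A : {set 'I_k} | #|A| == n]|.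
    by rewrite card_draws card_ord.
  rewrite !draws -cardsX.
  have inj1 : {in V &, injective fst} by move=> z z' zV z'V; apply: idle_unique.
  rewrite -(card_in_imset inj1); apply: eq_card => -[X Y]; rewrite !inE /=.
  apply/imsetP/andP => [[[[X' Y'] v]]|[cX cY]].
    by rewrite inE /= => /andP[/eqP cX /andP[cY _]] [-> ->]; rewrite (eqP cY) cX eqxx.
  have [v Xv] : exists v, idle X Y v by apply: idle_exists; rewrite (eqP cX) (eqP cY).
  by exists (X, Y, v); rewrite ?inE ?cX.
have [w [p0 sync]] := sync_push2 k m m.+1.
pose VP := [set p : {set 'I_k} * {set 'I_k} | (#|p.1| == m) && (#|p.2| == m.+1)].
(* The bottom row hops first, and its landing pad is the symbol of the top row. *)
pose Phi (zc : {set 'I_k} * {set 'I_k} * 'I_k * 'I_k) :=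
  let: (X, Y, v, c) := zc in
  (push X (landing Y c), push Y c, next_idle Y v c, landing X (landing Y c)).
rewrite (@lifted_law R _ _ (@push2 k) _ VP w p0 _ V f Phi).
- rewrite cV; congr (_%:R / _).
  have inj3 : injective (fun X : {set 'I_k} => (X, T, u)) by move=> X X' [].
  rewrite -(card_imset _ inj3); apply: eq_card => -[[X Y] u']; rewrite !inE /= xpair_eqE.
  apply/andP/imsetP => [[/andP[_ iX] /andP[/eqP YT /eqP eY]]|[X']].
    have /idleP[q /queue_idle/andP[u'Y _]] := iX; rewrite /= in eY; rewrite eY in u'Y YT iX.
    have e : u' = u.
      apply/eqP/negPn/negP => u'u; have := setD11 u T.
      by rewrite -YT in_setD1 eq_sym u'u uT.
    by exists X; rewrite ?inE -e // eY.
  rewrite inE => iX [-> -> ->]; rewrite iX !eqxx andbT; split=> //.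
  by case/andP: iX; rewrite cT eqSS eq_sym.
- by rewrite card_ord; lia.
- by rewrite cV muln_gt0 !bin_gt0 mk ltnW.
- apply: stationary_fiber hmu _; first by rewrite card_ord; lia.
  by move=> F c; rewrite !nasty_pads_act.
- by rewrite (sum_fiber_mass _ _ predT) /=; case: hmu => -[].
- move=> p pV; rewrite /fiber_mass big_pred0 // => F; apply/negP => /eqP Fp.
  by move: pV; rewrite inE -Fp /= !card_nasty_pads ?eqxx // ltnW.
- by move=> p; rewrite inE => /andP[/eqP c1 /eqP c2]; apply: sync.
- move=> [[X Y] v]; rewrite !inE /= => /andP[/eqP cX iv].
  have /idleP[q /queue_idle /andP[vY _]] := iv.
  case/andP: iv => /eqP cY _; rewrite cY cX eqxx andbT.
  by have := cardsD1 v Y; rewrite vY cY cX => -[->].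
- move=> [[[X Y] v] c] [[[X' Y'] v'] c']; rewrite !in_setX => /andP[zV _] /andP[zV' _].
  move=> [eX eY _ ey]; have [eX0 ey0] := push_inj eX ey.
  have [eY0 ec] := push_inj eY ey0; rewrite ec.
  by rewrite (idle_unique _ _ zV zV') //= eX0 eY0.
- move=> [[X Y] v] c; rewrite !inE /= => /andP[/eqP cX iv].
  have /idleP[q Q] := iv; have /andP[vY _] := queue_idle Q.
  rewrite card_push cX eqxx /f /push2 /=; split; last by rewrite push_idle.
  by apply/idleP; apply: queue_push Q.
Qed.

End Laws.

(** * Counting the arrivals that leave a given service idle *)

(** Times are counted from the idle pad u: the services are at distances
    b m = 0 < b (m-1) < ... < b 0 < k, so b decreases with the index, as the
    positions l_(i+1) do. *)
Section Count.
Variables (k m : nat) (u : 'I_k) (b : nat -> nat).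
Hypothesis bm : b m = 0.
Hypothesis b_lt : forall i, i < m -> b i.+1 < b i.
Hypothesis b0 : b 0 < k.
Implicit Types (X : {set 'I_k}) (x t : 'I_k).

Lemma b_le i j : i <= j <= m -> b j <= b i.
Proof.
case/andP=> + jm; elim: j jm => [|j IHj] jm; first by rewrite leqn0 => /eqP ->.
rewrite leq_eqVlt => /orP[/eqP -> //|ij].
exact: leq_trans (ltnW (b_lt jm)) (IHj (ltnW jm) ij).
Qed.

Definition block i : {set 'I_k} := [set x | b i.+1 < offset u x <= b i].
Definition services : {set 'I_k} := [set x | [exists i : 'I_m.+1, offset u x == b i]].

Lemma mem_service i : i <= m -> pad_add u (b i) \in services.
Proof.
move=> im; rewrite inE; apply/existsP; exists (Ordinal (im : i < m.+1)) => /=.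
by rewrite offset_pad_add //; have := @b_le 0 i; lia.
Qed.

Lemma card_block i : i < m -> #|block i| = b i - b i.+1.
Proof.
move=> im; have bk : b i < k by have := @b_le 0 i; lia.
have blt := b_lt im; have bk' : b i.+1 < k by lia.
pose rot x : 'I_k := Ordinal (offset_lt u x).
have rot_inj : injective rot by move=> x y [/offset_inj].
have -> : block i = rot @^-1: ([set x : 'I_k | x < (b i).+1] :\: [set x : 'I_k | x < (b i.+1).+1]).
  by apply/setP => x; rewrite !inE /= !ltnS -ltnNge.
rewrite card_preimset // cardsD (setIidPr _); first by rewrite !card_ord_lt // subSS.
by apply/subsetP => x; rewrite !inE; lia.
Qed.

Lemma upto_step X i : i < m -> upto u (b i) X = upto u (b i.+1) X + #|X :&: block i|.
Proof.
move=> im; rewrite /upto -(cardsID [set x | offset u x <= b i.+1]); congr (_ + _).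
  by apply: eq_card => x; rewrite !inE; have := b_lt im; case: (x \in X) => //=; lia.
by apply: eq_card => x; rewrite !inE; case: (x \in X) => //=; rewrite ?andbF //; lia.
Qed.

Lemma uptoE X j : j <= m -> upto u (b j) X = \sum_(j <= i < m) #|X :&: block i|.
Proof.
move=> jm; rewrite -(subKn jm); elim: (m - j) (leq_subr j m) => [_|n IHn nm].
  rewrite subn0 big_geq // bm; apply/eqP; rewrite cards_eq0 -subset0.
  by apply/subsetP => x; rewrite !inE; lia.
have e : (m - n.+1).+1 = m - n by lia.
have lt : m - n.+1 < m by lia.
by rewrite upto_step // e IHn ?(ltnW nm) // [RHS]big_ltn // e addnC.
Qed.

Lemma card_service_block i : i < m -> #|services :&: block i| = 1.
Proof.
move=> im; apply/eqP/cards1P; exists (pad_add u (b i)).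
have bk : b i < k by have := @b_le 0 i; lia.
apply/setP => x; rewrite in_set1 in_setI; apply/andP/eqP => [[]|->].
  rewrite !inE => /existsP[[j jm] /= /eqP xj] hx.
  have [e|ne] := eqVneq j i; first by rewrite -e -xj pad_add_offset.
  by have := @b_le i.+1 j; have := @b_le j.+1 i; have := @b_lt j; lia.
by rewrite mem_service ?(ltnW im) // inE offset_pad_add // leqnn andbT b_lt.
Qed.

Lemma upto_services j : j <= m -> upto u (b j) services = m - j.
Proof.
move=> jm; rewrite uptoE // big_nat_cond (eq_bigr (fun=> 1)).
  by rewrite -big_nat_cond sum_nat_const_nat muln1.
by move=> i /andP[/andP[_ im] _]; apply: card_service_block.
Qed.

Lemma upto_le X p q : p <= q -> upto u p X <= upto u q X.
Proof.
move=> pq; apply/subset_leq_card/subsetP => x.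
by rewrite !inE => /andP[-> /andP[-> /leq_trans ->]].
Qed.

Lemma upto_card X p : upto u p X <= #|X|.
Proof. by apply/subset_leq_card/subsetP => x; rewrite inE => /andP[]. Qed.

Lemma card_services : #|services| = m.+1.
Proof.
rewrite (cardsD1 u) -{1}[u]/(pad_add u 0) -{1}bm mem_service // add1n; congr _.+1.
rewrite -[RHS]subn0 -(upto_services (leq0n m)); apply: eq_card => x; rewrite !inE.
rewrite andbC lt0n offset_eq0; case: existsP => //= -[[i im] /= /eqP ->].
by rewrite b_le ?andbT.
Qed.

(** The number of services still ahead only changes at services, so the queue
    condition needs to be tested at these times alone. *)
Lemma idle_services X : reflect (#|X| = m /\ forall j, j < m -> m - j <= upto u (b j) X)
  (idle X services u).
Proof.
rewrite /idle card_services eqSS; apply: (iffP andP) => [[/eqP <- /forallP le]|[cX le]].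
  split=> // j jm; have := le (pad_add u (b j)); rewrite offset_pad_add.
    by rewrite upto_services // ltnW.
  by have := @b_le 0 j; lia.
split; first by rewrite cX.
apply/forallP => t; set p := offset u t.
have jP : exists j, (j <= m) && (b j <= p) by exists m; rewrite bm leqnn.
case: (ex_minnP jP) => j /andP[jm jp] minj.
apply: leq_trans (_ : upto u (b j) services <= _).
  apply/subset_leq_card/subsetP => x; rewrite !inE => /andP[xs /andP[-> xp]].
  rewrite xs /=; case/existsP: xs => -[i im] /= /eqP xi; rewrite xi b_le //.
  by rewrite minj //= -xi xp andbT.
rewrite upto_services //; apply: leq_trans (upto_le _ jp).
by have [lt|] := ltnP j m; [apply: le|rewrite -subn_eq0 => /eqP ->].
Qed.

Definition draws_of (a : {ffun 'I_m -> 'I_m.+1}) : {set {set 'I_k}} :=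
  [set X : {set 'I_k} | (X \subset [set x | 0 < offset u x <= b 0])
                        && [forall i : 'I_m, #|X :&: block i| == a i]].

Lemma block_cover x : 0 < offset u x <= b 0 -> exists i : 'I_m, x \in block i.
Proof.
move=> /andP[x0 xb].
have jP : exists j, (j <= m) && (b j < offset u x) by exists m; rewrite bm leqnn.
case: (ex_minnP jP) => -[|j] /andP[jm jx] minj; first by lia.
exists (Ordinal jm); rewrite inE jx leqNgt; apply/negP => lt.
by have := minj j; rewrite lt (ltnW jm) ltnn => /(_ isT).
Qed.

Lemma block_disjoint x (i j : 'I_m) : x \in block i -> x \in block j -> i = j.
Proof.
rewrite !inE => xi xj; apply: val_inj => /=; have im := ltn_ord i; have jm := ltn_ord j.
have [ij|ij|//] := ltngtP (i : nat) j.
- by have := @b_le i.+1 j; lia.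
- by have := @b_le j.+1 i; lia.
Qed.

Lemma card_draws_of a : #|draws_of a| = \prod_(i < m) 'C(b i - b i.+1, a i).
Proof.
pose Fam (i : 'I_m) : {set {set 'I_k}} := [set D : {set 'I_k} | D \subset block i & #|D| == a i].
have -> : \prod_(i < m) 'C(b i - b i.+1, a i) = #|family Fam|.
  rewrite card_family foldrE big_map big_enum; apply: eq_bigr => i _.
  by rewrite cards_draws card_block.
pose cut X : {ffun 'I_m -> {set 'I_k}} := [ffun i : 'I_m => X :&: block i].
have cut_inj : {in draws_of a &, injective cut}.
  suff sub X X' : X \in draws_of a -> cut X = cut X' -> X \subset X'.
    by move=> X X' XD X'D e; apply/eqP; rewrite eqEsubset !sub.
  rewrite inE => /andP[/subsetP XB _] /ffunP e; apply/subsetP => x xX.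
  have := XB x xX; rewrite inE => /block_cover[i xi].
  by have /setP/(_ x) := e i; rewrite !ffunE !in_setI xX xi => /esym/andP[].
rewrite -(card_in_imset cut_inj); apply: eq_card => D; apply/imsetP/familyP.
  move=> [X]; rewrite inE => /andP[_ /forallP Xa] -> i.
  by rewrite ffunE inE subsetIr Xa.
move=> FD; have DB i : D i \subset block i by have := FD i; rewrite inE => /andP[].
have cutD : cut (\bigcup_i D i) = D.
  apply/ffunP => i; rewrite ffunE; apply/setP => x; rewrite in_setI.
  apply/andP/idP => [[/bigcupP[j _ xj] xi]|xD].
    by rewrite (block_disjoint xi (subsetP (DB j) x xj)).
  by split; [apply/bigcupP; exists i|apply: (subsetP (DB i))].
exists (\bigcup_i D i) => //; rewrite inE; apply/andP; split.
  apply/bigcupsP => i _; apply: subset_trans (DB i) _; apply/subsetP => x.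
  rewrite !inE => /andP[lt le]; have := @b_le 0 i; have := ltn_ord i; lia.
apply/forallP => i; have /ffunP/(_ i) := cutD; rewrite ffunE => ->.
by have := FD i; rewrite inE => /andP[].
Qed.

(** The arrivals up to time b j are those outside the blocks 0, ..., j - 1, which
    turns lower bounds on their number into upper bounds on the partial sums.
    The case j = 0 says that nobody arrives after the last service. *)
Lemma card_idle :
  #|[set X | idle X services u]|
  = \sum_(a : {ffun 'I_m -> 'I_m.+1} | admissible a) \prod_(i < m) 'C(b i - b i.+1, a i).
Proof.
pose profile X : {ffun 'I_m -> 'I_m.+1} := [ffun i : 'I_m => inord #|X :&: block i|].
have uptoX X j : j <= m -> (\sum_(i < m | (i < j)%N) #|X :&: block i|) + upto u (b j) X = upto u (b 0) X.
  move=> jm; rewrite !uptoE // (big_cat_nat (leq0n j) jm) /=; congr (_ + _).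
  by rewrite big_mkord (big_ord_narrow jm).
have idleE X (a : {ffun 'I_m -> 'I_m.+1}) :
    idle X services u && (profile X == a) = admissible a && (X \in draws_of a).
  apply/andP/andP => [[/idle_services[cX le] /eqP <-]|[/andP[/forallP adm /eqP tot]]].
    have u0 : upto u (b 0) X = m.
      apply/eqP; rewrite eqn_leq -{1}cX upto_card /=.
      by case: (posnP m) => [->//|m0]; have := le 0 m0; rewrite subn0.
    have profE (i : 'I_m) : profile X i = #|X :&: block i| :> nat.
      rewrite ffunE inordK // ltnS -[X in _ <= X]cX.
      by apply/subset_leq_card/subsetP => x; rewrite inE => /andP[].
    split.
      apply/andP; split.
        apply/forallP => j; rewrite (eq_bigr _ (fun i _ => profE i)).
        rewrite -(leq_add2r (upto u (b j.+1) X)) (uptoX X j.+1 (ltn_ord j)) u0.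
        have [lt|] := ltnP j.+1 m; first by have := le _ lt; lia.
        by have := ltn_ord j; lia.
      rewrite (eq_bigr _ (fun i _ => profE i)); have := uptoE X (leq0n m).
      by rewrite u0 big_mkord => <-.
    rewrite inE; apply/andP; split; last by apply/forallP => i; rewrite profE.
    apply/subsetP => x xX.
    have : [set y in X | 0 < offset u y <= b 0] == X.
      rewrite eqEcard -/(upto u (b 0) X) u0 cX leqnn andbT.
      by apply/subsetP => y; rewrite inE => /andP[].
    by move=> /eqP/setP/(_ x); rewrite xX !inE => /andP[].
  rewrite inE => /andP[/subsetP XB /forallP Xa].
  have aE (i : 'I_m) : a i = #|X :&: block i| :> nat by rewrite (eqP (Xa i)).
  have u0 : upto u (b 0) X = m.
    by rewrite uptoE // big_mkord -[RHS]tot; apply: eq_bigr => i _; rewrite aE.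
  split; last first.
    by apply/eqP/ffunP => i; apply: ord_inj; rewrite ffunE -aE inord_val.
  apply/idle_services; split.
    rewrite -u0; apply: eq_card => x; rewrite inE.
    by case: (boolP (x \in X)) => // /XB; rewrite inE => ->.
  case=> [|j] jm; first by rewrite u0 subn0.
  have := adm (Ordinal (ltnW jm)); rewrite (eq_bigr _ (fun i _ => aE i)) /=.
  by rewrite -(leq_add2r (upto u (b j.+1) X)) (uptoX X j.+1 (ltnW jm)) u0 leq_subLR.
rewrite -sum1dep_card (partition_big profile (@admissible m)) => [|X iX]; last first.
  by have := idleE X (profile X); rewrite iX eqxx => /esym/andP[].
apply: eq_bigr => a adm; rewrite -card_draws_of -sum1_card.
by apply: eq_bigl => X; rewrite idleE adm.
Qed.

End Count.

(** * The conditional law of the next frog *)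

Local Open Scope ring_scope.

Lemma is_padE k (z : int) (x : 'I_k) : is_pad z x = (x%:Z == (z %% k)%Z).
Proof. by rewrite /is_pad modz_nat modn_small. Qed.

Lemma is_pad_exists k (z : int) : (0 < k)%N -> exists u : 'I_k, is_pad z u.
Proof.
move=> k0; have zk : (`|(z %% k)%Z| < k)%N.
  by have := @ltz_pmod z k; have := @modz_ge0 z k; lia.
exists (Ordinal zk); rewrite is_padE /=; have := @modz_ge0 z k; lia.
Qed.

Lemma is_pad_shift k (z : int) (u x : 'I_k) n : (n < k)%N -> is_pad z u ->
  is_pad (z + n%:Z) x = (offset u x == n).
Proof.
move=> nk; rewrite !is_padE => /eqP zu.
rewrite -modzDml -zu -PoszD modz_nat eqz_nat -val_pad_add (inj_eq val_inj).
by rewrite -{2}(offset_pad_add u nk) (inj_eq (@offset_inj _ u)).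
Qed.

(* W = 12...k is the identity word on the alphabet 'I_k, and the integer       *)
(* l_(i+1) is l i for i <= m; the other values of l are irrelevant.            *)
Theorem theorem4 (R : realFieldType) (k m : nat) (hm : (1 <= m)%N) (hmk : (m < k)%N)
    (mu : frog_arrangement k -> R)
    (hmu : stationary (frog_kernel R (fun x : 'I_k => x)) mu)
    (l : nat -> int)
    (hl : forall i : nat, (i < m)%N -> l i.+1 < l i)
    (hlk : l 0%N < l m + k%:Z) :
  cPr mu
    (fun F => is_pad (l m) (F (Ordinal hmk)))
    (fun F => [set F i | i : 'I_k & (i < m)%N]
              == [set x : 'I_k | [exists i : 'I_m, is_pad (l i) x]])
  = ('C(k, m.+1)%:R)^-1 *
    \sum_(a : {ffun 'I_m -> 'I_m.+1} | admissible a)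
      (\prod_(i < m) 'C(`|l i - l i.+1|, a i))%:R.
Proof.
have k0 : (0 < k)%N by apply: leq_ltn_trans hmk.
pose b i := `|l i - l m|%N.
have l_le i : (i <= m)%N -> l m <= l i.
  move=> im; rewrite -(subKn im); elim: (m - i)%N (leq_subr i m) => [|n IHn] nm.
    by rewrite subn0.
  have lt : (m - n.+1 < m)%N by lia.
  have e : ((m - n.+1).+1 = m - n)%N by lia.
  by apply: le_trans (IHn (ltnW nm)) _; have := hl _ lt; rewrite e => /ltW.
have bE i : (i <= m)%N -> l i = l m + (b i)%:Z by move=> /l_le; rewrite /b; lia.
have bm : b m = 0%N by rewrite /b subrr.
have b_lt i : (i < m)%N -> (b i.+1 < b i)%N.
  by move=> im; have := hl i im; have := l_le i.+1 im; rewrite /b; lia.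
have b0 : (b 0%N < k)%N by have := l_le 0%N (leq0n m); rewrite /b; lia.
have [u lmu] := is_pad_exists (l m) k0.
set S := [set x : 'I_k | [exists i : 'I_m, is_pad (l i) x]]; pose T := services m u b.
have padE i x : (i <= m)%N -> is_pad (l i) x = (offset u x == b i).
  move=> im; rewrite bE // (@is_pad_shift _ _ u) //.
  by apply: leq_ltn_trans b0; apply: (b_le b_lt).
have TE : T = u |: S.
  apply/setP => x; rewrite in_setU1 inE; apply/existsP/orP => [[[i im] /= xi]|[/eqP ->|]].
  - move: (im); rewrite ltnS leq_eqVlt => /orP[/eqP e|lt].
      by left; rewrite -offset_eq0 (eqP xi) e bm.
    by right; rewrite inE; apply/existsP; exists (Ordinal lt); rewrite padE // ltnW.
  - by exists ord_max; rewrite offset_same bm.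
  - rewrite inE => /existsP[i]; rewrite padE ?(ltnW (ltn_ord i)) // => xi.
    by exists (widen_ord (leqnSn m) i).
have uS : u \notin S.
  rewrite inE; apply/existsP => -[i]; rewrite padE ?(ltnW (ltn_ord i)) // offset_same.
  have := b_lt i (ltn_ord i); lia.
have cT : #|T| = m.+1 by apply: card_services.
have cS : #|S| = m by move: cT; rewrite TE cardsU1 uS => -[].
set o := Ordinal hmk.
have PrB : Pr mu (fun F => nasty_pads F m == S) = ('C(k, m)%:R)^-1.
  exact: (nasty_pads_uniform hmu k0 (ltnW hmk) cS).
have PrAB : Pr mu (predI (fun F : frog_arrangement k => is_pad (l m) (F o))
                          (fun F => nasty_pads F m == S))
    = #|[set X | idle X T u]|%:R / ('C(k, m) * 'C(k, m.+1))%:R.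
  have uT : u \in T by rewrite TE setU11.
  rewrite -(nasty_pads2_law hmu hmk cT uT) TE setU1K //.
  apply: eq_bigl => F /=; rewrite xpair_eqE andbC; case: eqP => //= FS.
  rewrite padE // bm offset_eq0 (nasty_padsS F hmk) -/o FS.
  apply/eqP/eqP => [-> //|/setP/(_ (F o))]; rewrite !in_setU1 eqxx /= => /esym/orP[/eqP //|].
  by rewrite -FS => /imsetP[i]; rewrite inE => im /perm_inj oi; rewrite -oi /= ltnn in im.
rewrite /cPr [X in _ / X]PrB [X in X / _]PrAB (card_idle u bm b_lt b0).
have C0 : 'C(k, m)%:R != 0 :> R by rewrite pnatr_eq0 -lt0n bin_gt0 ltnW.
rewrite invrK natrM invfM mulrC mulrCA mulVKf // mulrC -natr_sum.
congr (_ * _%:R); apply: eq_bigr => a _; apply: eq_bigr => i _.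
by congr ('C(_, _)); have := hl i (ltn_ord i); have := l_le i.+1 (ltn_ord i); rewrite /b; lia.
Qed.
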